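(* For every positive integer $n$, $$p^{(3)}(n)=\sum_{i\ge 1}\hat{p}^{(1)}_i\!\left(n-\binom{i}{2}\right),$$ where $p^{(3)}(n)$ is the number of partitions of $n$ with $3$-distant parts and, for an integer $m$ and $i\ge1$, $\hat{p}^{(1)}_i(m)$ is the number of partitions of $m$ into exactly $i$ distinct parts whose smallest even part is greater than twice the number of odd parts (with $\hat{p}^{(1)}_i(m)=0$ for $m\le 0$). Only the terms with $1\le i\le l(n,3)$ can be nonzero, where $l(n,3)$ is the maximal length of a partition of $n$ with $3$-distant parts.
   Context: A partition of $n$ is a non-increasing sequence of positive integers $\lambda_1\ge\cdots\ge\lambda_l$ summing to $n$; it has $d$-distant parts if $\lambda_j-\lambda_{j+1}\ge d$ for all $j<l$ (so $1$-distant means all parts are distinct). For a partition $\mu$ with distinct parts, $l_o(\mu)$ denotes its number of odd parts and $e(\mu)$ its smallest even part; the condition ''smallest even part greater than twice the number of odd parts'' means $e(\mu)>2l_o(\mu)$, and it is regarded as satisfied when $\mu$ has no even parts. *)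

(* Defs.v *)
From mathcomp Require Import all_boot all_order all_algebra.

Set Implicit Arguments.
Unset Strict Implicit.
Unset Printing Implicit Defensive.

Definition is_partition (n : nat) (s : seq nat) : bool :=
  [&& sorted geq s, all (fun k => 0 < k) s & sumn s == n].

(* Every partition of n has at most n parts, each at most n, so it occurs among
   the bounded sequences filtered here: see mem_partitions. *)
Definition partitions (n : nat) : seq (seq nat) :=
  [seq s <- [seq map val t | t : n.-bseq 'I_n.+1]
  | is_partition n s].

Lemma partitions_uniq n : uniq (partitions n).
Proof.
rewrite filter_uniq // map_inj_uniq ?enum_uniq // => t u.
by move/(inj_map val_inj)/val_inj.
Qed.

Lemma mem_partitions n s : (s \in partitions n) = is_partition n s.
Proof.
rewrite mem_filter; case: (boolP (is_partition n s)) => //= /and3P[_ pos /eqP sn].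
have le_n k : k \in s -> k < n.+1.
  by move=> ks; rewrite ltnS -sn (perm_sumn (perm_to_rem ks)) leq_addr.
have size_n : size s <= n.
  rewrite -sn; elim: s pos {sn le_n} => //= k s IH /andP[k0 /IH].
  by rewrite -add1n; apply: leq_add.
have size_t : size [seq inord k : 'I_n.+1 | k <- s] <= n by rewrite size_map.
apply/mapP; exists (Bseq size_t); first by rewrite mem_enum.
rewrite /= -map_comp -[LHS]map_id; apply/eq_in_map => k ks /=.
by rewrite inordK // le_n.
Qed.

(* The subtraction is truncated; on a partition it is the true difference. *)
Definition distant (d : nat) (s : seq nat) : bool :=
  sorted (fun x y => d <= x - y) s.

Definition num_distant (d n : nat) : nat := count (distant d) (partitions n).

Definition max_length (n d : nat) : nat :=
  \max_(s <- partitions n | distant d s) size s.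

Definition num_odd_parts (s : seq nat) : nat := count odd s.

Definition smallest_even_part (s : seq nat) : option nat :=
  if [seq x <- s | ~~ odd x] is x :: t then Some (foldr minn x t) else None.

Definition even_gt_twice_odd (s : seq nat) : bool :=
  if smallest_even_part s is Some e then 2 * num_odd_parts s < e else true.

Definition phat1 (i : nat) (m : int) : nat :=
  if (0 < m)%R then
    count (fun s => [&& distant 1 s, size s == i & even_gt_twice_odd s])
          (partitions `|m|%N)
  else 0.

(* Main.v *)
Require Import Defs.
From mathcomp Require Import all_boot all_order all_algebra.
From mathcomp Require Import zify.

(** For a fixed length [i], both sides are matched with the non-increasing
    sequences [v] of [i] natural numbers.  Adding the staircase
    [3(i-1)+1, ..., 4, 1] to [v] gives the 3-distant partitions with [i] parts.
    On the other side, reorder [v] so that its odd entries come first, add the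
    staircase [2i-1, ..., 3, 1] and sort.  This staircase flips parities, so the
    even parts of the result come from the odd entries of [v], and they all sit
    above the [k] steps occupied by the even entries: each exceeds [2k], where
    [k] is the number of odd parts.  The two staircases differ by
    [0 + 1 + ... + (i-1) = 'C(i, 2)]. *)

(** * Adding and removing a staircase *)

Fixpoint stair (d k : nat) (s : seq nat) : seq nat :=
  if s is x :: t then x + (d * (size t + k)).+1 :: stair d k t else [::].

(** The subtraction truncates, so adding the staircase back recovers [s] only when every entry is at
    least as large as its step; see [distant_head_gt]. *)
Fixpoint unstair (d k : nat) (s : seq nat) : seq nat :=
  if s is x :: t then x - (d * (size t + k)).+1 :: unstair d k t else [::].

Lemma size_stair d k s : size (stair d k s) = size s.
Proof. by elim: s => //= x s ->. Qed.

Lemma size_unstair d k s : size (unstair d k s) = size s.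
Proof. by elim: s => //= x s ->. Qed.

(** This is the purpose of the offset [k]: it counts the steps lying below, so a block of a longer
    sequence carries a staircase of its own. *)
Lemma stair_cat d k s t :
  stair d k (s ++ t) = stair d (size t + k) s ++ stair d k t.
Proof. by elim: s => //= x s ->; rewrite size_cat addnA. Qed.

Lemma unstair_cat d k s t :
  unstair d k (s ++ t) = unstair d (size t + k) s ++ unstair d k t.
Proof. by elim: s => //= x s ->; rewrite size_cat addnA. Qed.

Lemma stairK d k : cancel (stair d k) (unstair d k).
Proof. by elim=> //= x s ->; rewrite size_stair addnK. Qed.

(** The steps are [d * (j + k) + 1] for [j < size s], and these [j] add up to ['C(size s, 2)]. *)
Lemma sumn_stair d k s :
  sumn (stair d k s) = sumn s + d * 'C(size s, 2) + d * k * size s + size s.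
Proof.
elim: s => [|x s IH] /=; first by rewrite !muln0.
rewrite IH binS bin1; nia.
Qed.

Lemma distant_stair d k s : sorted geq s -> distant d (stair d k s).
Proof.
rewrite /distant; elim: s => [|x [|y s] IH] //= /andP[yx /IH /= ->].
rewrite andbT; nia.
Qed.

Lemma all_stair_gt d k s : all (fun x => d * k < x) (stair d k s).
Proof. by elim: s => //= x s ->; rewrite andbT; nia. Qed.

(** The last entry exceeds [d * k] and each move to the left gains at least [d]. Positivity of [d]
    keeps the truncated differences in [distant] from hiding an ascent. The bound makes the
    subtraction in [unstair] exact. *)
Lemma distant_head_gt {d k x s} :
  0 < d -> distant d (x :: s) -> all (fun y => d * k < y) (x :: s) ->
  d * (size s + k) < x.
Proof.
move=> d_gt0; elim: s x => [|y s IH] x /=; first by rewrite andbT.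
case/andP=> dxy dys /andP[_ ys_gt].
have := IH y dys ys_gt; lia.
Qed.

Lemma distant_behead {d x s} : distant d (x :: s) -> distant d s.
Proof. exact: path_sorted. Qed.

Lemma unstairK d k s :
  0 < d -> distant d s -> all (fun x => d * k < x) s ->
  stair d k (unstair d k s) = s.
Proof.
move=> d_gt0; elim: s => [|x s IH] // dxs xs_gt.
have x_gt := distant_head_gt d_gt0 dxs xs_gt.
move: xs_gt => /= /andP[_ s_gt].
by rewrite IH ?(distant_behead dxs) // size_unstair subnK.
Qed.

Lemma sorted_unstair d k s :
  0 < d -> distant d s -> all (fun x => d * k < x) s ->
  sorted geq (unstair d k s).
Proof.
move=> d_gt0; elim: s => [|x [|y s] IH] // dxs xs_gt.
have dys := distant_behead dxs.
have ys_gt : all (fun x => d * k < x) (y :: s) by case/andP: xs_gt.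
have y_gt := distant_head_gt d_gt0 dys ys_gt.
move: (IH dys ys_gt) dxs => /= -> /andP[dxy _].
rewrite andbT; lia.
Qed.

(** For [d = 2] every step is odd, so adding it flips the parity. *)
Lemma odd_stair2 k b s :
  all (fun x => odd x == b) s -> all (fun x => odd x == ~~ b) (stair 2 k s).
Proof.
elim: s => //= x s IH /andP[/eqP xb /IH ->].
by rewrite andbT oddD /= oddM /= xb addbT.
Qed.

Lemma odd_unstair2 k b s :
  distant 2 s -> all (fun x => 2 * k < x) s -> all (fun x => odd x == b) s ->
  all (fun x => odd x == ~~ b) (unstair 2 k s).
Proof.
elim: s => [|x s IH] // dxs xs_gt.
have x_gt := distant_head_gt (isT : 0 < 2) dxs xs_gt.
case/andP: xs_gt => _ s_gt /= /andP[/eqP xb s_b].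
rewrite IH ?(distant_behead dxs) // andbT.
by rewrite oddB // oddS oddM /= xb addbT.
Qed.

(** * Parity classes, sorting and distinctness *)

Definition odds_evens (s : seq nat) : seq nat :=
  filter odd s ++ filter (predC odd) s.

Definition evens_odds (s : seq nat) : seq nat :=
  filter (predC odd) s ++ filter odd s.

Lemma perm_odds_evens s : perm_eq (odds_evens s) s.
Proof. by rewrite /odds_evens perm_filterC. Qed.

Lemma perm_evens_odds s : perm_eq (evens_odds s) s.
Proof. by rewrite /evens_odds perm_catC perm_filterC. Qed.

Lemma geq_trans : transitive geq.
Proof. by move=> y x z /=; lia. Qed.

Lemma geq_total : total geq.
Proof. by move=> x y /=; lia. Qed.

Lemma geq_anti : antisymmetric geq.
Proof. by move=> x y /=; lia. Qed.

Lemma sort_geq_eq s t : sorted geq t -> perm_eq s t -> sort geq s = t.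
Proof.
move=> t_sorted st; apply: (sorted_eq geq_trans geq_anti) => //.
  exact: sort_sorted geq_total s.
by rewrite perm_sort.
Qed.

(** A sorted sequence is determined by its multiset, and filtering preserves sortedness. Parity
    classes of a sorted sequence can thus be read off without knowing how they interleave. *)
Lemma filter_sort_geq p s t :
  sorted geq t -> perm_eq (filter p s) t -> filter p (sort geq s) = t.
Proof.
move=> t_sorted st; apply: (sorted_eq geq_trans geq_anti) => //.
  exact: (sorted_filter geq_trans) (sort_sorted geq_total s).
by apply: perm_trans st; apply: perm_filter; rewrite perm_sort.
Qed.

Lemma filter_odd_cat s t :
  all (fun x => odd x == false) s -> all (fun x => odd x == true) t ->
  filter odd (s ++ t) = t /\ filter (predC odd) (s ++ t) = s.
Proof.
move=> s_even t_odd; rewrite !filter_cat.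
have -> : filter odd s = [::].
  by elim: s s_even => //= x s IH /andP[/eqP-> /IH].
have -> : filter odd t = t.
  by elim: t t_odd => //= x t IH /andP[/eqP-> /IH ->].
have -> : filter (predC odd) s = s.
  by elim: s s_even => //= x s IH /andP[/eqP-> /IH ->].
have -> : filter (predC odd) t = [::].
  by elim: t t_odd => //= x t IH /andP[/eqP-> /IH].
by rewrite cats0.
Qed.

Lemma distant_sorted_geq d s : 0 < d -> distant d s -> sorted geq s.
Proof. by move=> d_gt0; apply: sub_sorted => x y /=; lia. Qed.

Lemma distant1E s : distant 1 s = sorted geq s && uniq s.
Proof.
have gtn_trans : transitive (fun x y => 1 <= x - y) by move=> y x z; lia.
apply/idP/andP => [ds | []].
  split; first exact: distant_sorted_geq ds.
  by apply: sorted_uniq ds => // x; rewrite subnn.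
rewrite /distant; elim: s => [|x [|y s] IH] //= /andP[yx s_sorted].
rewrite inE negb_or => /andP[/andP[xy _] s_uniq].
rewrite [X in _ && X]IH //; lia.
Qed.

Lemma distant_filter d p s : 0 < d -> distant d s -> distant d (filter p s).
Proof. by move=> d_gt0; apply: sorted_filter => y x z; lia. Qed.

(** Distinct numbers of equal parity differ by at least 2. *)
Lemma distant2_same_parity b s :
  distant 1 s -> all (fun x => odd x == b) s -> distant 2 s.
Proof.
rewrite /distant; elim: s => [|x [|y s] IH] // /andP[dxy ds] /and3P[xb yb sb].
rewrite /= [X in _ && X]IH //=; last by rewrite yb.
move: dxy xb yb; rewrite andbT; lia.
Qed.

(** In this form the condition is the lower bound that [unstairK] asks of the even parts when the
    offset is the number of odd parts. *)
Lemma even_gt_twice_oddE s :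
  even_gt_twice_odd s =
  all (fun x => 2 * size (filter odd s) < x) (filter (predC odd) s).
Proof.
rewrite /even_gt_twice_odd /smallest_even_part /num_odd_parts size_filter.
move: (2 * count odd s) => m; rewrite -/(predC odd).
case: (filter _ s) => [|x t] //=; elim: t x => [|y t IH] x /=.
  by rewrite andbT.
by rewrite leq_min IH andbCA.
Qed.

Lemma all_odd_filter s : all (fun x => odd x == true) (filter odd s).
Proof. by apply/allP => x; rewrite mem_filter => /andP[->]. Qed.

Lemma all_even_filter s :
  all (fun x => odd x == false) (filter (predC odd) s).
Proof. by apply/allP => x; rewrite mem_filter => /andP[/= /negbTE->]. Qed.

(** * The correspondence by parity *)

Definition split_parity (v : seq nat) : seq nat :=
  sort geq (stair 2 0 (odds_evens v)).

(** Even parts go first because the parities are flipped: they stem from the odd entries, which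
    carried the upper steps. *)
Definition merge_parity (t : seq nat) : seq nat :=
  sort geq (unstair 2 0 (evens_odds t)).

Lemma filter_split_parity v : sorted geq v ->
  filter odd (split_parity v) = stair 2 0 (filter (predC odd) v) /\
  filter (predC odd) (split_parity v) =
    stair 2 (size (filter (predC odd) v)) (filter odd v).
Proof.
move=> v_sorted; rewrite /split_parity /odds_evens stair_cat addn0.
have v_even := odd_stair2 (size (filter (predC odd) v)) _ _ (all_odd_filter v).
have v_odd := odd_stair2 0 _ _ (all_even_filter v).
have [oddE evenE] := filter_odd_cat _ _ v_even v_odd.
have stair_sorted k p : sorted geq (stair 2 k (filter p v)).
  apply: (@distant_sorted_geq 2) => //; apply: distant_stair.
  exact: sorted_filter geq_trans _ _ v_sorted.
by split; apply: filter_sort_geq; rewrite // ?oddE ?evenE.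
Qed.

Lemma size_split_parity v : size (split_parity v) = size v.
Proof. by rewrite size_sort size_stair (perm_size (perm_odds_evens v)). Qed.

Lemma size_merge_parity t : size (merge_parity t) = size t.
Proof. by rewrite size_sort size_unstair (perm_size (perm_evens_odds t)). Qed.

Lemma sumn_split_parity v :
  sumn (split_parity v) = sumn v + 2 * 'C(size v, 2) + size v.
Proof.
rewrite (perm_sumn (permEl (perm_sort geq _))) sumn_stair.
rewrite (perm_sumn (perm_odds_evens v)) (perm_size (perm_odds_evens v)).
by rewrite muln0 mul0n addn0.
Qed.

(** The odd parts are as many as the even entries of [v], which is the offset of the block of even
    parts; [all_stair_gt] then gives the condition on the even parts. *)
Lemma split_parityP v : sorted geq v ->
  [/\ distant 1 (split_parity v), all (fun x => 0 < x) (split_parity v)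
    & even_gt_twice_odd (split_parity v)].
Proof.
move=> v_sorted; have [oddE evenE] := filter_split_parity v v_sorted.
have filter_sorted p : sorted geq (filter p v).
  exact: sorted_filter geq_trans _ _ v_sorted.
split.
- rewrite distant1E sort_sorted ?sort_uniq; last exact: geq_total.
  (* Distinctness is checked on the two parity blocks: each is strictly decreasing, and a common
     element would be both odd and even. *)
  rewrite -(sort_uniq geq) -(perm_uniq (perm_evens_odds _)) /evens_odds.
  rewrite -/(split_parity v) oddE evenE cat_uniq.
  have stair_uniq k p : uniq (stair 2 k (filter p v)).
    suff: distant 1 (stair 2 k (filter p v)) by rewrite distant1E => /andP[].
    by apply: sub_sorted (distant_stair 2 k _ (filter_sorted p)) => x y /ltnW.
  rewrite !stair_uniq /= andbT; apply/hasPn => x.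
  rewrite -oddE -evenE !mem_filter /= => /andP[-> _] //.
- by rewrite all_sort; have := all_stair_gt 2 0 (odds_evens v); rewrite muln0.
- rewrite even_gt_twice_oddE oddE evenE size_stair; exact: all_stair_gt.
Qed.

Lemma split_parityK v : sorted geq v -> merge_parity (split_parity v) = v.
Proof.
move=> v_sorted; have [oddE evenE] := filter_split_parity v v_sorted.
apply: sort_geq_eq => //; rewrite /evens_odds oddE evenE unstair_cat.
by rewrite size_stair addn0 !stairK; apply: perm_odds_evens.
Qed.

(** Within each parity class the parts are 2-distant, and the condition on even parts leaves room to
    subtract the steps above those used by the odd parts. Hence nothing truncates. *)
Lemma merge_parityK t :
  distant 1 t -> all (fun x => 0 < x) t -> even_gt_twice_odd t ->
  split_parity (merge_parity t) = t.
Proof.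
move=> dt t_gt0; rewrite even_gt_twice_oddE => even_gt.
have := dt; rewrite distant1E => /andP[t_sorted _].
have dist_even : distant 2 (filter (predC odd) t).
  by apply: distant2_same_parity (all_even_filter t); apply: distant_filter.
have dist_odd : distant 2 (filter odd t).
  by apply: distant2_same_parity (all_odd_filter t); apply: distant_filter.
have odd_gt : all (fun x => 2 * 0 < x) (filter odd t).
  by rewrite all_filter; apply: sub_all t_gt0 => x /= ->; rewrite implybT.
have even_odd := odd_unstair2 _ _ _ dist_even even_gt (all_even_filter t).
have odd_even := odd_unstair2 _ _ _ dist_odd odd_gt (all_odd_filter t).
have [oddE evenE] := filter_odd_cat _ _ odd_even even_odd.
(* The blocks are swapped to put the even entries first, as [filter_odd_cat] expects. *)
have permE p : perm_eq (filter p (unstair 2 0 (evens_odds t)))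
    (filter p (unstair 2 0 (filter odd t) ++
               unstair 2 (size (filter odd t)) (filter (predC odd) t))).
  by apply: perm_filter; rewrite unstair_cat addn0 perm_catC.
apply: sort_geq_eq => //; rewrite /odds_evens.
rewrite (filter_sort_geq odd _ _ _ (permE _)) oddE ?sorted_unstair //.
rewrite (filter_sort_geq (predC odd) _ _ _ (permE _)) evenE ?sorted_unstair //.
rewrite stair_cat size_unstair addn0 !unstairK //; exact: perm_evens_odds.
Qed.

(** * The bijection for a fixed number of parts *)

Definition dist3_part (i n : nat) (s : seq nat) : bool :=
  is_partition n s && (distant 3 s && (size s == i)).

Definition phat_part (i m : nat) (s : seq nat) : bool :=
  is_partition m s && [&& distant 1 s, size s == i & even_gt_twice_odd s].

Definition to_phat (s : seq nat) : seq nat := split_parity (unstair 3 0 s).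

Definition of_phat (t : seq nat) : seq nat := stair 3 0 (merge_parity t).

Lemma to_phatP i n s : dist3_part i n s ->
  phat_part i (n - 'C(i, 2)) (to_phat s) /\ of_phat (to_phat s) = s.
Proof.
case/andP=> /and3P[_ s_gt0 /eqP s_sum] /andP[ds /eqP s_size].
have s_gt : all (fun x => 3 * 0 < x) s by rewrite muln0.
have v_sorted := sorted_unstair _ _ _ (isT : 0 < 3) ds s_gt.
have vK := unstairK _ _ _ (isT : 0 < 3) ds s_gt.
rewrite /of_phat /to_phat split_parityK // vK; split=> //.
have [dt t_gt0 t_even] := split_parityP _ v_sorted.
have := dt; rewrite distant1E => /andP[t_sorted _].
apply/andP; split; last by rewrite dt size_split_parity size_unstair s_size eqxx.
apply/and3P; split=> //; apply/eqP.
(* With [v] the unstaired sequence, [n] is [sumn v + 3 * 'C(i, 2) + i], while the image sums to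
   [sumn v + 2 * 'C(i, 2) + i]. *)
have := sumn_stair 3 0 (unstair 3 0 s).
rewrite vK sumn_split_parity size_unstair s_size s_sum; lia.
Qed.

Lemma of_phatP i n t : 'C(i, 2) <= n -> phat_part i (n - 'C(i, 2)) t ->
  dist3_part i n (of_phat t) /\ to_phat (of_phat t) = t.
Proof.
move=> le_n /andP[/and3P[_ t_gt0 /eqP t_sum]] /and3P[dt /eqP t_size t_even].
have tK := merge_parityK _ dt t_gt0 t_even.
rewrite /to_phat /of_phat stairK tK; split=> //.
have v_sorted : sorted geq (merge_parity t) by apply: sort_sorted geq_total _.
have ds := distant_stair 3 0 _ v_sorted.
rewrite /dist3_part ds size_stair size_merge_parity t_size eqxx !andbT.
apply/and3P; split; first exact: distant_sorted_geq ds.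
  by have := all_stair_gt 3 0 (merge_parity t); rewrite muln0.
have := sumn_split_parity (merge_parity t).
rewrite tK sumn_stair size_merge_parity t_size t_sum => ?; apply/eqP; lia.
Qed.

(** * From the bijection to the counts *)

Lemma leq_count_inj (T : eqType) (a b : pred T) (s t : seq T) (f g : T -> T) :
  uniq s -> (forall x, x \in s -> a x -> (f x \in t) && b (f x)) ->
  (forall x, x \in s -> a x -> g (f x) = x) -> count a s <= count b t.
Proof.
move=> s_uniq f_t fK; rewrite -!size_filter -(size_map f).
apply: uniq_leq_size.
  rewrite map_inj_in_uniq ?filter_uniq // => x y.
  rewrite !mem_filter => /andP[ax xs] /andP[ay ys] fxy.
  by rewrite -(fK x) // fxy fK.
move=> _ /mapP[x + ->]; rewrite !mem_filter => /andP[ax xs].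
by rewrite andbC f_t.
Qed.

(** Each inequality comes from an injection, the two maps exchanging the roles of injection and left
    inverse. *)
Lemma count_dist3_phat i n : 'C(i, 2) <= n ->
  count (fun s => distant 3 s && (size s == i)) (partitions n) =
  count (fun s => [&& distant 1 s, size s == i & even_gt_twice_odd s])
        (partitions (n - 'C(i, 2))).
Proof.
move=> le_n; apply/eqP; rewrite eqn_leq; apply/andP; split.
  apply: (@leq_count_inj _ _ _ _ _ to_phat of_phat); first exact: partitions_uniq.
    move=> s; rewrite !mem_partitions => sn ds.
    by have [] := to_phatP i n s; rewrite /dist3_part ?sn.
  move=> s; rewrite mem_partitions => sn ds.
  by have [] := to_phatP i n s; rewrite /dist3_part ?sn.
apply: (@leq_count_inj _ _ _ _ _ of_phat to_phat); first exact: partitions_uniq.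
  move=> s; rewrite !mem_partitions => sn ds.
  by have [] := of_phatP i n s le_n; rewrite /phat_part ?sn.
move=> s; rewrite mem_partitions => sn ds.
by have [] := of_phatP i n s le_n; rewrite /phat_part ?sn.
Qed.

(** The staircase alone already weighs [3 * 'C(i, 2) + i]. The summand [i] makes [n - 'C(i, 2)]
    strictly positive when [i > 0]. *)
Lemma dist3_sum_bound i n s :
  s \in partitions n -> distant 3 s -> size s = i -> 'C(i, 2) + i <= n.
Proof.
rewrite mem_partitions => /and3P[_ s_gt0 /eqP <-] ds s_size.
have s_gt : all (fun x => 3 * 0 < x) s by rewrite muln0.
rewrite -(unstairK _ _ _ (isT : 0 < 3) ds s_gt) sumn_stair size_unstair s_size.
lia.
Qed.

(** Positivity of [i] excludes the empty partition: for [i = n = 0] the left side is 0 by convention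
    and the right side is 1. *)
Lemma phat1E i n : 0 < i ->
  phat1 i (n%:Z - 'C(i, 2)%:Z)%R =
  count (fun s => distant 3 s && (size s == i)) (partitions n).
Proof.
move=> i_gt0; rewrite /phat1; case: ifP => [lt_n|le_n].
  have le_n : 'C(i, 2) <= n by lia.
  by rewrite count_dist3_phat //; congr (count _ (partitions _)); lia.
(* Here [n <= 'C(i, 2)], so [phat1] takes its default value 0, and [dist3_sum_bound] leaves no
   partition to count. *)
apply/esym/eqP; rewrite -leqn0 leqNgt -has_count.
apply/hasPn => s s_n; apply/negP => /andP[ds /eqP s_size].
have := dist3_sum_bound _ _ _ s_n ds s_size; lia.
Qed.

Theorem theorem2 (n : nat) (hn : 0 < n) :
  (forall i : nat, 1 <= i ->
     phat1 i (n%:Z - 'C(i, 2)%:Z)%R <> 0 -> i <= max_length n 3)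
  /\
  (forall N : nat, max_length n 3 <= N ->
     num_distant 3 n = \sum_(1 <= i < N.+1) phat1 i (n%:Z - 'C(i, 2)%:Z)%R).
Proof.
have le_max s : s \in partitions n -> distant 3 s -> size s <= max_length n 3.
  by move=> s_n ds; rewrite /max_length (big_rem s) //= ds leq_maxl.
split=> [i i_gt0|N le_N].
  rewrite phat1E // => /eqP; rewrite -lt0n -has_count.
  by case/hasP=> s s_n /andP[ds /eqP <-]; apply: le_max.
under eq_big_nat => i /andP[i_gt0 _] do rewrite phat1E // -sum1_count.
rewrite /num_distant -sum1_count.
(* After exchanging the sums, each 3-distant partition contributes exactly once, at the index equal
   to its length. *)
under [RHS]eq_bigr => i _ do rewrite big_mkcond /=.
rewrite exchange_big big_mkcond /= big_seq [RHS]big_seq.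
apply: eq_bigr => s s_n; case ds: (distant 3 s); last by rewrite big1.
(* Since [n > 0] the partition is nonempty, so its length is in the index range, which starts at
   1. *)
have s_gt0 : 0 < size s.
  by case: s s_n {ds} => //; rewrite mem_partitions => /and3P[_ _ /eqP /=]; lia.
have s_le : size s <= N by apply: leq_trans (le_max s s_n ds) le_N.
rewrite (bigD1_seq (size s)) ?mem_index_iota ?iota_uniq ?s_gt0 //= eqxx.
by rewrite big1 // => i; rewrite eq_sym => /negbTE->.
Qed.
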